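(* Let $q\ge 2$ be an integer and let $A$ be an alphabet with $q$ letters. For $n\in\mathbb{N}$ let $R_n$ denote the number of rich words of length $n$ over $A$. Then $\lim_{n\to\infty}\sqrt[n]{R_n}=1$.
   Context: A finite word $u=u_1\cdots u_n$ over $A$ is a palindrome if $u_1u_2\cdots u_n=u_nu_{n-1}\cdots u_1$; the empty word is a palindrome and a factor of every word. A word $w$ of length $n$ is called rich if it has exactly $n+1$ distinct palindromic factors (including the empty word); every word of length $n$ has at most $n+1$ distinct palindromic factors. *)

(* Defs.v *)
From mathcomp Require Import all_boot.

Set Implicit Arguments.
Unset Strict Implicit.
Unset Printing Implicit Defensive.

Definition palindrome (A : eqType) (u : seq A) : bool := rev u == u.

(* A factor of [w] is at most as long as [w], so the palindromic factors of [w]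
   form a finite set of words of length bounded by [size w]. *)
Definition pal_factors (A : finType) (w : seq A) : {set (size w).-bseq A} :=
  [set u : (size w).-bseq A | palindrome u & infix u w].

Definition rich (A : finType) (w : seq A) : bool :=
  #|pal_factors w| == (size w).+1.

Definition nb_rich (A : finType) (n : nat) : nat :=
  #|[set w : n.-tuple A | rich w]|.

(* Main.v *)
(** A rich word is a product of pairwise distinct rich palindromes: repeatedly
    split off the palindromic prefix that does not occur further to the right.
    Over a finite alphabet, distinct words of total length [n] number only
    [o(n)], so at subexponential cost a rich word of length [n] is described by
    the halves of these palindromes, themselves rich words of total length about
    [n / 2].  Hence [nb_rich A n <= c x ^ n] improves to the same bound with a
    base arbitrarily close to [sqrt x], and iterating drives the base to 1. *)
Require Import Defs.
From mathcomp Require Import all_boot all_order all_algebra.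
From mathcomp Require Import all_classical all_reals all_analysis.
From mathcomp Require Import zify lra ring.
Import numFieldNormedType.Exports.
Import Order.TTheory GRing.Theory Num.Theory.

Local Set Implicit Arguments.
Local Unset Strict Implicit.

Lemma size_flatten_iota (T : Type) (F : nat -> seq T) n :
  size (flatten [seq F i | i <- iota 0 n]) = \sum_(i < n) size (F i).
Proof.
rewrite size_flatten /shape -map_comp sumnE big_map -[X in iota _ X]subn0.
by rewrite -/(index_iota 0 n) big_mkord.
Qed.

(** * Palindromic factors and richness *)

Section RichWords.
Variable A : finType.
Implicit Types (a : A) (u v w : seq A) (P Q : pred (seq A)).

Definition pal_factor_seq w : seq (seq A) := map val (enum (pal_factors w)).

Lemma uniq_pal_factor_seq w : uniq (pal_factor_seq w).
Proof. by rewrite map_inj_uniq ?enum_uniq //; exact: val_inj. Qed.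

Lemma mem_pal_factor_seq w u :
  (u \in pal_factor_seq w) = palindrome u && infix u w.
Proof.
apply/mapP/andP => [[v] | [pal_u u_w]].
  by rewrite mem_enum inE => /andP[? ?] ->.
by exists (Bseq (size_infix u_w)); rewrite // mem_enum inE pal_u.
Qed.

Lemma size_pal_factor_seq w : size (pal_factor_seq w) = #|pal_factors w|.
Proof. by rewrite size_map cardE. Qed.

(* Of two new palindromic prefixes, the shorter would also be a suffix of the
   longer one, hence occur in [w]. *)
Lemma new_pal_prefix_uniq a w u v :
  palindrome u -> palindrome v -> infix u (a :: w) -> infix v (a :: w) ->
  ~~ infix u w -> ~~ infix v w -> u = v.
Proof.
wlog le_uv : u v / size u <= size v.
  move=> H pu pv iu iv nu nv; case/orP: (leq_total (size u) (size v)) => h.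
    exact: H.
  by apply/esym/H.
move=> /eqP pu /eqP pv; rewrite !infix_consl => /orP[pre_u|->] // /orP[pre_v|->] //.
move=> nu _; move: pre_u (pre_v); rewrite !prefixE => /eqP eu /eqP ev.
have tu : take (size u) v = u by rewrite -ev take_takel.
have : v = rev (drop (size u) v) ++ u.
  by rewrite -[LHS]pv -[in LHS](cat_take_drop (size u) v) tu rev_cat pu.
case: (rev _) => [|b t] // ev'; apply: contraNeq nu => _.
move: pre_v; rewrite ev' prefix_cons => /andP[_ /prefixW].
exact/infix_trans/suffix_infix.
Qed.

(** By [new_pal_prefix_uniq] all palindromic factors absent from [w] coincide, so a new letter adds
    at most one; the boolean [has] counts it as 0 or 1. *)
Lemma card_pal_factors_cons a w :
  #|pal_factors (a :: w)| <= #|pal_factors w| +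
    has (fun u => ~~ infix u w) (pal_factor_seq (a :: w)).
Proof.
rewrite -!size_pal_factor_seq; case: hasP => [[u] | noN].
  rewrite mem_pal_factor_seq => /andP[pu iu] nu; rewrite addn1.
  apply: (@uniq_leq_size _ _ (u :: pal_factor_seq w)); first exact: uniq_pal_factor_seq.
  move=> v; rewrite inE !mem_pal_factor_seq => /andP[pv iv]; rewrite pv.
  case: (boolP (infix v w)) => [_ | nv]; first by rewrite orbT.
  by rewrite (new_pal_prefix_uniq pv pu iv iu nv nu) eqxx.
rewrite addn0; apply: uniq_leq_size; first exact: uniq_pal_factor_seq.
move=> v vin; have := vin; rewrite !mem_pal_factor_seq => /andP[-> _] /=.
by apply/negPn/negP => nv; apply: noN; exists v.
Qed.

Lemma card_pal_factors_le w : #|pal_factors w| <= (size w).+1.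
Proof.
elim: w => [|a w IH].
  rewrite -size_pal_factor_seq; apply: (@uniq_leq_size _ _ [:: [::]]).
    exact: uniq_pal_factor_seq.
  by move=> v; rewrite mem_pal_factor_seq infixs0 inE => /andP[].
apply: leq_trans (card_pal_factors_cons a w) _.
by rewrite -addn1 leq_add // leq_b1.
Qed.

(** A gain of at most one reaches the maximum only if [w] already attains its own and the gain
    occurs. The new palindrome, absent from [w], must start at the letter [a]. *)
Lemma rich_cons a w : rich (a :: w) ->
  rich w /\ exists u, [/\ palindrome u, prefix u (a :: w) & ~~ infix u w].
Proof.
rewrite /rich => /eqP rw; have := card_pal_factors_cons a w.
have := card_pal_factors_le w; rewrite {}rw /=.
case: hasP => [[u] | _]; last by lia.
rewrite mem_pal_factor_seq infix_consl => /andP[pu iu] nu le1 le2; split; first by lia.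
by exists u; split=> //; move: iu; rewrite (negPf nu) orbF.
Qed.

Lemma rich_drop k w : rich w -> rich (drop k w).
Proof. by elim: w k => [|a w IH] [|k] //= /rich_cons[/IH]. Qed.

Lemma rich_rev w : rich (rev w) = rich w.
Proof.
rewrite /rich -!size_pal_factor_seq size_rev; congr (_ == _).
apply/perm_size/uniq_perm; try exact: uniq_pal_factor_seq.
move=> u; rewrite !mem_pal_factor_seq; case: (boolP (palindrome u)) => //= /eqP pu.
by rewrite -{1}pu infix_rev.
Qed.

Lemma rich_take k w : rich w -> rich (take k w).
Proof. by rewrite -(rich_rev w) -(rich_rev (take k w)) rev_take => /rich_drop. Qed.

(** The powers of [a] already give [n.+1] palindromic factors. This makes [nb_rich] positive, whence
    the lower bound in the limit. *)
Lemma rich_nseq n a : rich (nseq n a).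
Proof.
rewrite /rich eqn_leq card_pal_factors_le -size_pal_factor_seq size_nseq.
rewrite -[X in X <= _](size_iota 0) -(size_map (fun k => nseq k a)) uniq_leq_size //.
  by rewrite map_inj_uniq ?iota_uniq // => i j /(congr1 size); rewrite !size_nseq.
move=> u /mapP[k]; rewrite mem_iota => /andP[_ lek] ->.
rewrite mem_pal_factor_seq /palindrome rev_nseq eqxx /=.
by apply/prefixW/prefixP; exists (nseq (n - k) a); rewrite -nseqD subnKC.
Qed.

(** * Factorization into distinct rich palindromes *)

Definition rich_pal u := palindrome u && rich u.

(* Cutting off the new palindromic prefix repeatedly never yields the same
   palindrome twice, since that prefix does not occur further to the right. *)
Lemma rich_factorization w : rich w ->
  exists s, [/\ uniq s, [::] \notin s, all rich_pal s & flatten s = w].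
Proof.
have [n] := ubnP (size w); elim: n w => // n IH [|a w] /=; first by exists [::].
rewrite ltnS => lt_wn rw; have [_ [u [pu pre_u nu]]] := rich_cons rw.
case: u => [|b u] in pu pre_u nu *; first by rewrite infix0s in nu.
have /prefixP[v ev] := pre_u.
have [eb ew] : a = b /\ w = u ++ v by case: ev.
have rv : rich v by rewrite -[v](@drop_size_cat _ (size (b :: u)) (b :: u)) // -ev rich_drop.
case: (IH v _ rv) => [|s [us s0 rs fs]].
  by rewrite (leq_ltn_trans _ lt_wn) // ew size_cat leq_addl.
exists ((b :: u) :: s); split => /=.
- rewrite us andbT; apply: contra nu => u_s; rewrite ew.
  apply: (@infix_trans _ v); last exact: suffix_infix.
  move: u_s; rewrite -fs; elim: (s) => //= c s' IHs; rewrite inE => /orP[/eqP <-|].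
    exact: prefix_infix.
  by move=> /IHs; move/infix_trans; apply; exact: suffix_infix.
- by rewrite inE.
- rewrite rs andbT /rich_pal pu.
  by rewrite -[b :: u](@take_size_cat _ (size (b :: u)) _ v) // -ev rich_take.
- by rewrite fs ev.
Qed.

(** * Counting rich palindromes and their products *)

Definition words n P : seq (seq A) := map val (enum [set w : n.-tuple A | P w]).

Lemma mem_words n P u : (u \in words n P) = (size u == n) && P u.
Proof.
apply/mapP/andP => [[v] | [/eqP su Pu]].
  by rewrite mem_enum inE => Pv ->; rewrite size_tuple.
by exists (tcast su (in_tuple u)); rewrite ?mem_enum ?inE /= ?val_tcast.
Qed.

Lemma uniq_words n P : uniq (words n P).
Proof. by rewrite map_inj_uniq ?enum_uniq //; exact: val_inj. Qed.

Lemma size_words_rich n : size (words n (@rich A)) = nb_rich A n.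
Proof. by rewrite size_map -cardE. Qed.

(** A palindrome is recovered from its first [uphalf k] letters, and this prefix of a rich word is
    rich. *)
Lemma size_words_rich_pal k : size (words k rich_pal) <= nb_rich A (uphalf k).
Proof.
rewrite -size_words_rich -(size_map (fun v => v ++ rev (take k./2 v)) (words (uphalf k) (@rich A))).
apply: uniq_leq_size; first exact: uniq_words.
move=> u; rewrite mem_words => /and3P[/eqP su /eqP pu ru].
have [le_half le_uphalf addE] : [/\ k./2 <= uphalf k, uphalf k <= k & k - uphalf k = k./2].
  by have := odd_double_half k; rewrite uphalf_half; split; lia.
apply/mapP; exists (take (uphalf k) u).
  by rewrite mem_words rich_take // andbT size_takel ?su.
rewrite take_takel // -[in LHS](cat_take_drop (uphalf k) u); congr (_ ++ _).
by rewrite -[in take _ u]pu take_rev revK su -addE subKn.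
Qed.

(** Index [k] stands for a first factor of length [k.+1], so all factors are nonempty. Distinctness
    enters only through the bound on [p]. *)
Fixpoint pal_product p w := if p is p'.+1 then
    has (fun k => rich_pal (take k.+1 w) && pal_product p' (drop k.+1 w)) (iota 0 (size w))
  else w == [::].

Lemma pal_product_flatten s : [::] \notin s -> all rich_pal s -> pal_product (size s) (flatten s).
Proof.
elim: s => //= u s IH; rewrite inE negb_or => /andP[u0 s0] /andP[ru rs].
have u_gt0 : 0 < size u by rewrite lt0n size_eq0 eq_sym.
apply/hasP; exists (size u).-1; first by rewrite mem_iota size_cat; lia.
by rewrite prednK // take_size_cat // drop_size_cat // ru IH.
Qed.

Lemma size_words_pal_product p n :
  size (words n (pal_product p.+1)) <=
  \sum_(k < n) size (words k.+1 rich_pal) * size (words (n - k.+1) (pal_product p)).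
Proof.
pose pairs k := [seq u ++ v | u <- words k.+1 rich_pal, v <- words (n - k.+1) (pal_product p)].
have -> : \sum_(k < n) size (words k.+1 rich_pal) * size (words (n - k.+1) (pal_product p))
    = size (flatten [seq pairs k | k <- iota 0 n]).
  by rewrite size_flatten_iota; apply: eq_bigr => k _; rewrite size_allpairs.
apply: uniq_leq_size; first exact: uniq_words.
move=> u; rewrite mem_words => /= /andP[/eqP su /hasP[k]].
rewrite su mem_iota add0n => /andP[_ ltkn] /andP[rk fk].
apply/flattenP; exists (pairs k); first by apply: map_f; rewrite mem_iota.
rewrite -(cat_take_drop k.+1 u); apply: allpairs_f; rewrite mem_words ?rk ?fk andbT.
  by rewrite size_takel ?su.
by rewrite size_drop su.
Qed.

(** Only finitely many words are shorter than [L], and [C] counts them; every other entry of [s] has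
    length at least [L]. As [L] is arbitrary, the number of distinct factors is sublinear in the
    total length. *)
Lemma size_uniq_le L : exists C, forall s : seq (seq A), uniq s ->
  L * size s <= size (flatten s) + L * C.
Proof.
pose short := flatten [seq words i predT | i <- iota 0 L].
exists (size short) => s us.
have le_short : size [seq u <- s | size u < L] <= size short.
  apply: uniq_leq_size; first exact: filter_uniq.
  move=> u; rewrite mem_filter => /andP[lt_uL _]; apply/flattenP.
  exists (words (size u) predT); last by rewrite mem_words eqxx.
  by apply/mapP; exists (size u); rewrite ?mem_iota.
(* Each entry is charged [L], paid by its own length if long and by the second summand if short. *)
apply: (@leq_trans (size (flatten s) + L * size [seq u <- s | size u < L])); last first.
  by rewrite leq_add2l leq_mul2l le_short orbT.
elim: s {us le_short} => //= u s IH; rewrite size_cat mulnS.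
by case: ltnP => ? /=; lia.
Qed.

Lemma nb_rich_le_pal_product L : 0 < L -> exists C, forall n,
  nb_rich A n <= \sum_(p < (C + n %/ L).+1) size (words n (pal_product p)).
Proof.
move=> L_gt0; have [C HC] := size_uniq_le L; exists C => n.
have -> : \sum_(p < (C + n %/ L).+1) size (words n (pal_product p)) =
    size (flatten [seq words n (pal_product p) | p <- iota 0 (C + n %/ L).+1]).
  by rewrite size_flatten_iota.
rewrite -size_words_rich; apply: uniq_leq_size; first exact: uniq_words.
move=> w; rewrite mem_words => /andP[/eqP sw /rich_factorization[s [us s0 rs fs]]].
apply/flattenP; exists (words n (pal_product (size s))); last first.
  by rewrite mem_words sw eqxx -fs pal_product_flatten.
apply: (map_f (fun p => words n (pal_product p))); rewrite mem_iota /= add0n ltnS -leq_subLR leq_divRL // mulnBl.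
by rewrite leq_subLR addnC -sw -fs mulnC [C * L]mulnC; exact: HC.
Qed.

Lemma nb_rich_le_exp n : nb_rich A n <= #|A| ^ n.
Proof. by rewrite -card_tuple max_card. Qed.

Lemma nb_rich_gt0 n : 0 < #|A| -> 0 < nb_rich A n.
Proof.
case/card_gt0P => a _; apply/card_gt0P; exists (nseq_tuple n a).
by rewrite inE rich_nseq.
Qed.

End RichWords.

Local Open Scope classical_set_scope.
Local Open Scope ring_scope.

(** * Exponential growth rate of the number of rich words *)

Section Growth.
Variables (R : realType) (A : finType).
Implicit Types (s c : R).

Lemma sum_geometric_le s n : 1 < s -> \sum_(k < n) s^-1 ^+ k.+1 <= (s - 1)^-1.
Proof.
move=> s1; have s0 : 0 < s by lra.
suff -> : \sum_(k < n) s^-1 ^+ k.+1 = (1 - s^-1 ^+ n) / (s - 1).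
  rewrite ler_piMl ?invr_ge0 ?subr_ge0 ?(ltW s1) // gerBl exprn_ge0 //.
  by rewrite invr_ge0 ltW.
elim: n => [|n IH]; first by rewrite big_ord0 expr0 subrr mul0r.
rewrite big_ord_recr /= {}IH exprS; move: (_ ^+ n) => z; field; lra.
Qed.

Lemma exists_le_expr s x : 1 < s -> exists n, x <= s ^+ n.
Proof.
move=> s1; have s1_gt0 : 0 < s - 1 by lra.
exists (Num.trunc (Num.max 0 (x / (s - 1)))).+1.
set N := _.+1.
have hN : x / (s - 1) <= N%:R.
  have := Num.Theory.truncnS_gt (Num.max 0 (x / (s - 1))).
  by rewrite gt_max => /andP[_ /ltW].
rewrite ler_pdivrMr // in hN; apply: le_trans hN _.
(* Bernoulli's inequality; with [t = s - 1] the induction rests on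
   [(1 + t)(1 + y t) = 1 + (y + 1) t + y t^2]. *)
suff : 1 + N%:R * (s - 1) <= s ^+ N by lra.
elim: N => [|N IH]; first by rewrite mul0r addr0 expr0.
rewrite exprS -natr1; have : 0 <= N%:R :> R by [].
move: (N%:R : R) (s ^+ N) IH => y z yz y0.
have h1 : 0 <= s * (z - (1 + y * (s - 1))) by rewrite mulr_ge0; lra.
have h2 : 0 <= y * (s - 1) ^+ 2 by rewrite mulr_ge0 // sqr_ge0.
nra.
Qed.

(* With weight [s ^- (j.+1 * k)] on words of length [k], all nonempty rich
   palindromes together weigh at most [c * s ^+ j / (s - 1)]. *)
Lemma pal_product_growth s c j : 1 < s ->
  (forall n, (nb_rich A n)%:R <= c * s ^+ (2 * j * n)) ->
  forall p n, (size (words n (@pal_product A p)))%:R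
    <= (2 + c * s ^+ j / (s - 1)) ^+ p * s ^+ (j.+1 * n).
Proof.
move=> s1 Hc; have s0 : 0 < s by lra.
have c0 : 0 <= c by have := Hc 0; rewrite muln0 expr0 mulr1; apply: le_trans.
(* The summand 2 serves [sum_expr_le] later. *)
set K := 2 + _.
have K0 : 0 <= K.
  by rewrite addr_ge0 // !mulr_ge0 ?invr_ge0 ?exprn_ge0 //; lra.
elim=> [|p IH] n.
  rewrite expr0 mul1r; apply: (@le_trans _ _ 1); last by rewrite exprn_ege1 // ltW.
  rewrite (ler_nat R _ 1) (@uniq_leq_size _ _ [:: [::]]) ?uniq_words // => u.
  by rewrite mem_words inE => /andP[].
(* Having [j.+1] instead of [j] in the exponent leaves a factor [s^-1 ^+ k.+1], which makes the sum
   over first lengths geometric. *)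
apply: (@le_trans _ _ (\sum_(k < n) c * s ^+ j * K ^+ p * s ^+ (j.+1 * n) * s^-1 ^+ k.+1)).
  apply: (@le_trans _ _ (\sum_(k < n)
    size (words k.+1 (@rich_pal A)) * size (words (n - k.+1) (@pal_product A p)))%:R).
    by rewrite ler_nat size_words_pal_product.
  rewrite natr_sum; apply: ler_sum => -[k ltkn] _; rewrite natrM /=.
  (* Since [2 * uphalf k.+1 <= k.+2], rounding the half length up costs at most a factor [s ^+ j],
     absorbed in [K]. *)
  apply: (@le_trans _ _ (c * s ^+ (j * k.+2) * (K ^+ p * s ^+ (j.+1 * (n - k.+1))))).
    apply: ler_pM => //.
    apply: (@le_trans _ _ (nb_rich A (uphalf k.+1))%:R).
      by rewrite ler_nat size_words_rich_pal.
    apply: le_trans (Hc _) _; rewrite ler_wpM2l // ler_weXn2l ?(ltW s1) //.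
    rewrite mulnAC mulnC leq_mul2l; apply/orP; right.
    by have := odd_double_half k; move=> /=; lia.
  have [m nE] : exists m, n = (k.+1 + m)%N by exists (n - k.+1)%N; rewrite subnKC.
  rewrite nE.
  rewrite addKn le_eqVlt; apply/orP; left; apply/eqP.
  rewrite exprVn; apply: (mulIf (lt0r_neq0 (exprn_gt0 k.+1 s0))).
  rewrite mulfVK ?lt0r_neq0 ?exprn_gt0 //.
  have -> : (j.+1 * (k.+1 + m) = j * k.+1 + k.+1 + j.+1 * m)%N by lia.
  have -> : (j * k.+2 = j * k.+1 + j)%N by lia.
  by rewrite !exprD; ring.
rewrite -mulr_sumr exprS.
apply: (@le_trans _ _ (c * s ^+ j * K ^+ p * s ^+ (j.+1 * n) / (s - 1))).
  by rewrite ler_wpM2l ?sum_geometric_le // !mulr_ge0 ?exprn_ge0 // ltW.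
have -> : c * s ^+ j * K ^+ p * s ^+ (j.+1 * n) / (s - 1) =
  (c * s ^+ j / (s - 1)) * (K ^+ p * s ^+ (j.+1 * n)) by ring.
by rewrite -[leRHS]mulrA ler_wpM2r ?lerDr // mulr_ge0 ?exprn_ge0 // ltW.
Qed.

Lemma sum_expr_le (K : R) n : 2 <= K -> \sum_(p < n) K ^+ p <= K ^+ n.
Proof.
move=> K2; elim: n => [|n IH]; first by rewrite big_ord0 expr0.
rewrite big_ord_recr exprS /=.
have : 0 <= K ^+ n by rewrite exprn_ge0 //; lra.
move: IH; move: (K ^+ n) => z; nra.
Qed.

(** Halving the palindromes turns [2 * j] into [j]; summing over their lengths costs one more
    exponent, and the number of factors another. *)
Lemma growth_step s j : 1 < s ->
  (exists c, forall n, (nb_rich A n)%:R <= c * s ^+ (2 * j * n)) ->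
  exists c, forall n, (nb_rich A n)%:R <= c * s ^+ (j.+2 * n).
Proof.
move=> s1 [c Hc]; have s0 : 0 < s by lra.
have c0 : 0 <= c by have := Hc 0; rewrite muln0 expr0 mulr1; apply: le_trans.
have := pal_product_growth s1 Hc; set K := 2 + _ => HK.
have K2 : 2 <= K.
  by rewrite lerDl !mulr_ge0 ?invr_ge0 ?exprn_ge0 //; lra.
have K0 : 0 <= K by lra.
(* This [L] gives [K ^+ (n %/ L) <= s ^+ n]; the remaining [K ^+ C.+1] is constant in [n]. *)
have [L KL] := exists_le_expr K s1.
have L_gt0 : (0 < L)%N by case: L KL => //; rewrite expr0; lra.
have [C HC] := nb_rich_le_pal_product A L_gt0.
exists (K ^+ C.+1) => n.
apply: (@le_trans _ _ (\sum_(p < (C + n %/ L).+1) (size (words n (@pal_product A p)))%:R)).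
  by rewrite -natr_sum ler_nat.
apply: (@le_trans _ _ (\sum_(p < (C + n %/ L).+1) K ^+ p * s ^+ (j.+1 * n))).
  by apply: ler_sum.
rewrite -mulr_suml; apply: (@le_trans _ _ (K ^+ (C + n %/ L).+1 * s ^+ (j.+1 * n))).
  by rewrite ler_wpM2r ?sum_expr_le // exprn_ge0 // ltW.
rewrite -addSn exprD -mulrA ler_wpM2l ?exprn_ge0 // (mulSn j.+1) exprD.
rewrite ler_wpM2r ?exprn_ge0 ?(ltW s0) //.
apply: (@le_trans _ _ (s ^+ (L * (n %/ L)))).
  by rewrite exprM lerXn2r // nnegrE ?exprn_ge0 // ltW.
by rewrite ler_weXn2l ?(ltW s1) // mulnC leq_trunc_div.
Qed.

(** One step takes [2 * m.+4] to [m.+6 <= 2 * m.+3], so the exponent descends to [2 * 3]. What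
    matters is that 6 does not depend on [s]. *)
Lemma growth_small s : 1 < s ->
  exists c, forall n, (nb_rich A n)%:R <= c * s ^+ (6 * n).
Proof.
move=> s1; have [m qm] := exists_le_expr #|A|%:R s1.
have mono k l : (k <= l)%N ->
    (exists c, forall n, (nb_rich A n)%:R <= c * s ^+ (k * n)) ->
    exists c, forall n, (nb_rich A n)%:R <= c * s ^+ (l * n).
  move=> kl [c Hc]; exists c => n; apply: le_trans (Hc n) _.
  rewrite ler_wpM2l ?ler_weXn2l ?(ltW s1) ?leq_mul2r ?kl ?orbT //.
  by have := Hc 0; rewrite muln0 expr0 mulr1; apply: le_trans.
have : exists c, forall n, (nb_rich A n)%:R <= c * s ^+ (2 * m.+3 * n).
  apply: (@mono m); first by lia.
  exists 1 => n; rewrite mul1r; apply: (@le_trans _ _ (#|A|%:R ^+ n)).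
    by rewrite -natrX ler_nat nb_rich_le_exp.
  by rewrite exprM lerXn2r ?nnegrE ?exprn_ge0 //; lra.
elim: m {qm} => // m IH /(growth_step s1) H; apply: IH; apply: mono H; lia.
Qed.

End Growth.

(** * From growth bounds to the limit *)

Theorem theorem3 (R : realType) (q : nat) (hq : (2 <= q)%N)
    (A : finType) (hA : #|A| = q) :
  (fun n : nat => (nb_rich A n)%:R `^ (n%:R^-1) : R) @ \oo --> (1 : R).
Proof.
apply/cvgrPdist_le => e e0.
(* Six of the seven powers of [s] come from [growth_small]; the seventh absorbs [c] once
   [n >= N]. *)
pose s : R := (1 + e) `^ (7%:R^-1).
have s7 : s ^+ 7 = 1 + e.
  by rewrite -powR_mulrn ?powR_ge0 // -powRrM mulVf ?pnatr_eq0 // powRr1 //; lra.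
have s0 : 0 <= s by exact: powR_ge0.
have s1 : 1 < s.
  by rewrite ltNge; apply/negP => h; have := exprn_ile1 7 s0 h; rewrite s7; lra.
have [c Hc] := growth_small A s1.
have [N cN] := exists_le_expr c s1.
near=> n.
have n0 : (0 < n)%N by near: n; exists 1%N.
have Nn : (N <= n)%N by near: n; exists N.
have nE : (n%:R : R) != 0 by rewrite pnatr_eq0 -lt0n.
have r1 : 1 <= (nb_rich A n)%:R :> R.
  by rewrite (ler_nat R 1) nb_rich_gt0 // hA; apply: leq_trans hq.
have lo : 1 <= (nb_rich A n)%:R `^ n%:R^-1 :> R.
  have e1 : 1 `^ n%:R^-1 = 1 :> R by rewrite powR1.
  by rewrite -[leLHS]e1 ge0_ler_powR ?nnegrE ?invr_ge0.
have hi : (nb_rich A n)%:R `^ n%:R^-1 <= 1 + e.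
  have -> : 1 + e = ((1 + e) ^+ n) `^ n%:R^-1.
    by rewrite -powR_mulrn -?powRrM ?mulfV ?powRr1 //; lra.
  rewrite ge0_ler_powR ?nnegrE ?exprn_ge0 //; first lra.
  apply: le_trans (Hc n) _; rewrite -s7 -exprM (mulSn 6) exprD.
  rewrite ler_wpM2r ?exprn_ge0 // (le_trans cN) // ler_weXn2l // ltW //.
rewrite distrC ger0_norm ?subr_ge0 //; lra.
Unshelve. all: by end_near.
Qed.
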